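(* Let $A>0$, $T>t_0\ge 0$, $\lambda\ge 0$, $\sigma>0$ and $k_0\ge 0$ be given real parameters. For any $\alpha\in(0,1]$ and $\beta\in(0,1]$, the following optimal control problem possesses a global solution: maximize $$\int_{t_0}^{T}[1-s(t)]^{\beta}\,k^{\alpha\beta}(t)\,e^{-\lambda t}\,dt$$ over $k\in W^{1,1}([t_0,T],\mathbb{R})$ and measurable functions $s:[t_0,T]\to\mathbb{R}$ satisfying $$\begin{cases}\dot k(t)=A\,k^{\alpha}(t)\,s(t)-\sigma k(t), & \text{a.e. } t\in[t_0,T],\\ k(t_0)=k_0,\\ s(t)\in[0,1], & \text{a.e. } t\in[t_0,T],\\ k(t)\in[0,+\infty), & \forall t\in[t_0,T].\end{cases}$$
   Context: $W^{1,1}([t_0,T],\mathbb{R})$ is the space of absolutely continuous functions $k:[t_0,T]\to\mathbb{R}$; measurability and integrals are in the Lebesgue sense. A pair $(k,s)$ satisfying all the listed constraints, with Lebesgue integrable integrand in the objective, is called a feasible process. A global solution is a feasible process $(\bar k,\bar s)$ at which the value of the objective integral is greater than or equal to its value at every feasible process. *)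

(* Defs.v *)
From mathcomp Require Import all_boot all_order all_algebra.
From mathcomp Require Import all_classical all_reals all_analysis.

Set Implicit Arguments.
Unset Strict Implicit.
Unset Printing Implicit Defensive.

Import Order.TTheory GRing.Theory Num.Theory.
Import numFieldNormedType.Exports.

Local Open Scope classical_set_scope.
Local Open Scope ring_scope.

(** [lebesgue_measure] lives on the Borel sigma-algebra of [R]; Lebesgue
    measurability is measurability for the completed sigma-algebra, which the
    library puts on the following alias of [R], the domain of
    [completed_lebesgue_measure]. *)
Definition lebesgue_type (R : realType) : measurableType _ :=
  caratheodory_type (wlength (R := R) idfun)^*%mu.

(** The measurable space [R] in the codomain is the Borel one. *)
Definition lebesgue_measurable_fun (R : realType) (D : set R) (f : R -> R) :
  Prop :=
  measurable_fun (D : set (lebesgue_type R)) (f : lebesgue_type R -> R).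

(** Functions on [[a, b]] are represented by total functions [R -> R]; only
    their values on [[a, b]] are constrained. *)
Definition absolutely_continuous (R : realType) (a b : R) (f : R -> R) : Prop :=
  forall eps : R, 0 < eps -> exists2 delta : R, 0 < delta &
    forall (n : nat) (x y : 'I_n -> R),
      (forall i, [/\ a <= x i, x i <= y i & y i <= b]) ->
      trivIset [set: 'I_n] (fun i => `]x i, y i[%classic) ->
      \sum_(i < n) (y i - x i) < delta ->
      \sum_(i < n) `|f (y i) - f (x i)| < eps.

Section ControlProblem.
Context {R : realType}.
Variables (A t0 T lambda sigma k0 alpha beta : R).
Implicit Types k s : R -> R.

Local Notation mu := (@completed_lebesgue_measure R).

Definition running_payoff k s (t : R) : R :=
  (1 - s t) `^ beta * k t `^ (alpha * beta) * expR (- lambda * t).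

Definition payoff k s : R :=
  \int[mu]_(t in `[t0, T]) running_payoff k s t.

(** In the state equation the two-sided derivative is used; the values of [k]
    outside [[t0, T]] can affect it only at the two end points, a null set. *)
Record feasible_process k s : Prop := FeasibleProcess {
  feasible_state_ac : absolutely_continuous t0 T k ;
  feasible_control_measurable : lebesgue_measurable_fun `[t0, T] s ;
  feasible_dynamics : {ae mu, forall t : R, t0 <= t <= T ->
    is_derive t 1 k (A * k t `^ alpha * s t - sigma * k t)} ;
  feasible_initial : k t0 = k0 ;
  feasible_control : {ae mu, forall t : R, t0 <= t <= T -> 0 <= s t <= 1} ;
  feasible_state : forall t : R, t0 <= t <= T -> 0 <= k t ;
  feasible_integrable : mu.-integrable `[t0, T] (EFin \o running_payoff k s) }.

Definition global_solution k s : Prop :=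
  feasible_process k s /\
  forall k' s', feasible_process k' s' -> payoff k' s' <= payoff k s.

End ControlProblem.

(* Main.v *)
Require Import Defs.
From mathcomp Require Import all_boot all_order all_algebra.
From mathcomp Require Import all_classical all_reals all_analysis.
From mathcomp Require Import measurable_realfun lra ring.
Import Order.TTheory GRing.Theory Num.Theory.
Import numFieldNormedType.Exports.
Local Open Scope classical_set_scope.
Local Open Scope ring_scope.
Set Implicit Arguments.
Unset Strict Implicit.
Unset Printing Implicit Defensive.

(** The problem is concave once it is written in the right unknown. Scale the
    capital by the integrating factor, [K t = expR (sigma * t) * k t], and take
    as control the scaled investment
    [z t = A * expR (sigma * t) * k t `^ alpha * s t]. The state equation
    becomes [K' = z], so [K] is an affine function of [z]; the constraint
    [0 <= s <= 1] becomes [0 <= z <= c_z], where the capacity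
    [c_z t = A * expR (sigma * (1 - alpha) * t) * K t `^ alpha] is a concave
    function of [z]; and the payoff becomes the integral of
    [weight t * (c_z t - z t) `^ beta], again a concave function of [z].
    By Gronwall's inequality all such [z] are bounded by one constant.

    A concave, or merely quasiconcave, functional on a bounded convex set of
    [L^2] that is closed under almost everywhere convergence attains its maximum
    ([quasiconcave_attains_max]). No weak topology is needed. Let [S] be the
    supremum of the functional and choose [z_n] of almost minimal [L^2] norm in
    the convex set where the value is at least [S - 1 / n]. These sets
    decrease, so the midpoint of [z_m] and [z_n], for [m <= n], belongs to the
    set of index [m], and the parallelogram identity shows that the sequence is
    Cauchy in [L^2]. A subsequence converges almost everywhere, and its limit is
    a maximiser.

    Conversely, an arbitrary feasible process has to be turned into a scaled
    control. This requires the fundamental theorem of calculus for absolutely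
    continuous functions, which follows from the fact that an absolutely
    continuous function whose derivative is almost everywhere nonpositive is
    nonincreasing ([ac_nonincreasing]); the same fact gives Gronwall's
    inequality. The control of a process is only Lebesgue measurable; a Borel
    version of [z] is obtained as a limit of difference quotients of [K]. *)

(** * Absolutely continuous functions and the sign of the derivative *)

Section almost_everywhere_monotone.
Context d (T : measurableType d) (R : realType).
Variable mu : {measure set T -> \bar R}.
Implicit Types P Q S : T -> Prop.

Lemma aeS P Q : {ae mu, forall t, P t} -> (forall t, P t -> Q t) ->
  {ae mu, forall t, Q t}.
Proof. by move=> Pae PQ; apply: filterS Pae; exact: PQ. Qed.

Lemma aeS2 P Q S : {ae mu, forall t, P t} -> {ae mu, forall t, Q t} ->
  (forall t, P t -> Q t -> S t) -> {ae mu, forall t, S t}.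
Proof. by move=> Pae Qae PQS; apply: filterS2 Pae Qae; exact: PQS. Qed.

End almost_everywhere_monotone.

(** Induction along a segment: a property of the points of [[a, b]] that holds
    at [a] and passes, near each [c], from every point on the left of [c] to
    every point on the right of [c] holds at [b]. *)
Lemma real_induction (R : realType) (a b : R) (P : R -> Prop) : a <= b -> P a ->
  (forall c, a <= c <= b -> exists2 r, 0 < r & forall x y,
     a <= x -> x <= c -> c <= y -> y <= b -> c - r < x -> y < c + r ->
     P x -> P y) ->
  P b.
Proof.
move=> ab Pa step.
pose S := [set x | [/\ a <= x, x <= b & P x]].
have Sa : S a by split.
have supS : has_sup S by split; [exists a | exists b => x []].
have aS : a <= sup S by apply: ub_le_sup => //; exact: supS.2.
have Sb : sup S <= b by apply: ge_sup; [exists a | move=> x []].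
have [r r0 stepr] := step (sup S) (introT andP (conj aS Sb)).
have [x [ax xb Px] xr] := sup_adherent r0 supS.
have xS : x <= sup S by apply: ub_le_sup => //; exact: supS.2.
have := stepr x (Num.min b (sup S + r / 2)) ax xS.
have Sr : sup S < sup S + r / 2 by rewrite ltrDl divr_gt0.
have yr : Num.min b (sup S + r / 2) < sup S + r.
  by rewrite gt_min; apply/orP; right; lra.
rewrite le_min Sb (ltW Sr) ge_min lexx => /(_ isT isT xr yr Px) Py.
have Smin : S (Num.min b (sup S + r / 2)).
  split; rewrite ?ge_min ?lexx// le_min ab /=.
  by apply: (le_trans aS); exact: ltW.
have : Num.min b (sup S + r / 2) <= sup S.
  by apply: ub_le_sup => //; exact: supS.2.
rewrite ge_min => /orP[bS|]; last by rewrite leNgt Sr.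
by move: Py; rewrite min_l// (le_trans bS)// ltW.
Qed.

Section ac_monotone.
Context {R : realType}.
Local Notation mu := (@lebesgue_measure R).

Lemma trivIset_pairwise (s : seq (R * R)) :
  pairwise (fun p q => q.2 <= p.1) s ->
  trivIset [set: 'I_(size s)]
    (fun i => `](nth (0, 0) s i).1, (nth (0, 0) s i).2[%classic).
Proof.
move=> ps; apply/trivIsetP => i j _ _.
wlog ij : i j / (i < j)%N => [H|_].
  move=> /[dup] ij; rewrite -val_eqE neq_ltn => /orP[/H|/H]; first exact.
  by rewrite setIC eq_sym; apply.
have /(pairwiseP (0, 0)) := ps.
move=> /(_ i j (ltn_ord i) (ltn_ord j) ij) /= ji.
apply/seteqP; split => // t /=; rewrite !in_itv/= => -[/andP[it _]] /andP[_ tj].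
by move: (lt_le_trans tj ji); rewrite ltNge (ltW it).
Qed.

Lemma sum_length_le (n : nat) (x y : 'I_n -> R) (U : set R) :
  measurable U -> (forall i, x i <= y i) -> (forall i, `]x i, y i[ `<=` U) ->
  trivIset [set: 'I_n] (fun i => `]x i, y i[%classic) ->
  ((\sum_(i < n) (y i - x i))%:E <= mu U)%E.
Proof.
move=> mU xy xyU tI.
have -> : (\sum_(i < n) (y i - x i))%:E =
    (\sum_(i < n) mu `]x i, y i[)%E.
  rewrite -sumEFin; apply: eq_bigr => i _.
  rewrite lebesgue_measure_itv/= lte_fin lt_neqAle xy andbT.
  by case: eqVneq => [->|]//=; rewrite subrr.
rewrite -(@measure_bigsetU_ord _ _ _ mu n xpredT (fun i => `]x i, y i[%classic))//.
  apply: le_measure; rewrite ?inE//.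
    by apply: bigsetU_measurable => i _.
  by apply: (big_ind (fun X : set R => X `<=` U)) => // X Y XU YU t [/XU|/YU].
Qed.

Lemma is_derive_approx (f : R -> R) (c d eps : R) : 0 < eps ->
  is_derive c 1 f d -> exists2 r, 0 < r &
  forall y, `|y - c| < r -> `|f y - f c - d * (y - c)| <= eps * `|y - c|.
Proof.
move=> eps0 [fd fE].
have : h^-1 *: (f (h *: 1 + c) - f c) @[h --> 0^'] --> d.
  by rewrite -fE; exact: fd.
move=> /cvgrPdist_le /(_ _ eps0) [r /= r0 H].
exists r => // y ycr.
have [->|yc] := eqVneq y c; first by rewrite !subrr mulr0 subrr normr0 mulr0.
have yc0 : y - c != 0 by rewrite subr_eq0.
have := H (y - c); rewrite /= distrC subr0 => /(_ ycr yc0).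
rewrite /GRing.scale /= mulr1 subrK => H'.
have -> : f y - f c - d * (y - c) = - ((d - (y - c)^-1 * (f y - f c)) * (y - c)).
  by field.
by rewrite normrN normrM ler_pM2r// normr_gt0.
Qed.

(** Fix [e > 0] and cover the null set of bad points by an open set [U] of small
    measure. Induction along [[a, b]] gives finitely many disjoint intervals
    contained in [U] such that [f b - f a] is at most a multiple of [e] plus the
    variation of [f] over these intervals; the latter is small by absolute
    continuity. *)
Lemma ac_nonincreasing (a b : R) (f : R -> R) : a <= b ->
  absolutely_continuous a b f ->
  {ae mu, forall t, a <= t <= b -> exists2 d, d <= 0 & is_derive t 1 f d} ->
  f b <= f a.
Proof.
move=> ab acf aef; apply/ler_addgt0Pr => e e0.
pose eps := e / (b - a + 1).
have ba : 0 < b - a + 1 by lra.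
have eps0 : 0 < eps by rewrite divr_gt0.
have [delta delta0 acd] := acf _ eps0.
pose N := ~` [set t | a <= t <= b -> exists2 d, d <= 0 & is_derive t 1 f d].
have N0 : ((wlength idfun)^* N)%mu = 0%E by apply/negligible_outer_measure.
have d20 : 0 < delta / 2 by rewrite divr_gt0.
have [U [oU NU muU]] := outer_measure_open_le N d20.
rewrite N0 add0e in muU.
pose chain (x : R) (s : seq (R * R)) :=
  [/\ forall p, p \in s -> [/\ a <= p.1, p.1 <= p.2, p.2 <= x &
        `]p.1, p.2[%classic `<=` U],
      pairwise (fun p q => q.2 <= p.1) s &
      f x - f a <= eps * (x - a) + \sum_(p <- s) `|f p.2 - f p.1|].
have [s [s1 s2 s3]] : exists s, chain b s.
  apply: (@real_induction _ a b (fun x => exists s, chain x s)) => //.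
    by exists [::]; split => //; rewrite big_nil !subrr mulr0 addr0.
  (* Near a bad point add one interval of [U] to the list; near a good point use
     the bound on the difference quotients and keep the list. *)
  move=> c acb; have [cN|cN] := pselect (N c).
    have [r /= r0 rU] : exists2 r : R, 0 < r & ball c r `<=` U.
      by apply/nbhs_ballP; apply: open_nbhs_nbhs; split => //; exact: NU.
    exists r => // x y ax xc cy yb xr yr [s [s1 s2 s3]].
    exists ((x, y) :: s); split.
    - move=> p; rewrite inE => /predU1P[->/=|/s1[p1 p2 p3 p4]]; split => //.
      + lra.
      + move=> t /=; rewrite in_itv/= => /andP[xt ty].
        by apply: rU; rewrite /ball/= ltr_norml; lra.
      + by rewrite (le_trans p3)// (le_trans xc).
    - by rewrite /= s2 andbT; apply/allP => p /s1[].
    - rewrite big_cons /=.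
      have := ler_norm (f y - f x).
      have : eps * (x - a) <= eps * (y - a) by rewrite ler_pM2l//; lra.
      lra.
  have [d d0 fd] : exists2 d, d <= 0 & is_derive c 1 f d.
    by have /contrapT := cN; exact.
  have [r r0 fr] := is_derive_approx eps0 fd.
  exists r => // x y ax xc cy yb xr yr [s [s1 s2 s3]].
  exists s; split => //.
    by move=> p /s1[p1 p2 p3 p4]; split => //; lra.
  have /fr : `|y - c| < r by rewrite ger0_norm; lra.
  have /fr : `|x - c| < r by rewrite ler0_norm; lra.
  rewrite !ler_norml => /andP[+ _] /andP[_].
  rewrite (@ler0_norm _ (x - c)) ?(@ger0_norm _ (y - c)); [|lra..].
  have : d * (y - c) <= 0 by rewrite mulr_le0_ge0//; lra.
  have : 0 <= d * (x - c) by rewrite mulr_le0//; lra.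
  lra.
have pn (i : 'I_(size s)) : nth (0, 0) s i \in s by rewrite mem_nth.
have tI := trivIset_pairwise s2.
have Ul : \sum_(i < size s) ((nth (0, 0) s i).2 - (nth (0, 0) s i).1) < delta.
  rewrite -lte_fin; apply: le_lt_trans (_ : (delta / 2)%:E < _)%E.
    apply: (le_trans (sum_length_le _ _ _ tI) muU).
    - exact: open_measurable.
    - by move=> i; case: (s1 _ (pn i)).
    - by move=> i; case: (s1 _ (pn i)).
  by rewrite lte_fin; lra.
have := acd _ _ _ _ tI Ul.
have /[swap] /[apply] : forall i : 'I_(size s), [/\ a <= (nth (0, 0) s i).1,
     (nth (0, 0) s i).1 <= (nth (0, 0) s i).2 & (nth (0, 0) s i).2 <= b].
  by move=> i; case: (s1 _ (pn i)).
rewrite -(big_mkord xpredT (fun i => `|f (nth (0, 0) s i).2 - f (nth (0, 0) s i).1|)).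
rewrite -(big_nth (0, 0) xpredT (fun p => `|f p.2 - f p.1|)) => se.
have : eps * (b - a) + eps = e by rewrite /eps; field; lra.
lra.
Qed.

End ac_monotone.

Section ac_algebra.
Context {R : realType}.
Implicit Types (f g : R -> R) (a b : R).

Lemma ac_uniform a b f : absolutely_continuous a b f ->
  forall eps, 0 < eps -> exists2 delta, 0 < delta &
  forall x y, a <= x -> x <= y -> y <= b -> y - x < delta ->
    `|f y - f x| < eps.
Proof.
move=> acf eps /acf [delta d0 H]; exists delta => // x y ax xy yb yx.
have := H 1 (fun=> x) (fun=> y); rewrite !big_ord1; apply => //.
by apply/trivIsetP => i j _ _; rewrite !ord1 eqxx.
Qed.

Lemma ac_bounded a b f : absolutely_continuous a b f ->
  exists2 M, 0 <= M & forall t, a <= t <= b -> `|f t| <= M.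
Proof.
move=> acf; have [ba|ab] := ltP b a.
  by exists 0 => // t /andP[at_ tb]; move: (le_trans at_ tb); rewrite leNgt ba.
have [delta d0 ud] := ac_uniform acf ltr01.
apply: (@real_induction _ a b
  (fun x => exists2 M, 0 <= M & forall t, a <= t <= x -> `|f t| <= M)) => //.
  by exists `|f a| => // t; rewrite -eq_le => /eqP <-.
move=> c _; exists (delta / 2); first by rewrite divr_gt0.
move=> x y ax xc cy yb xr yr [M M0 fM]; exists (M + 1); first lra.
move=> t /andP[at_ ty]; have [tx|xt] := leP t x.
  by rewrite (le_trans (fM t _)) ?at_// lerDl.
have fx : `|f x| <= M by apply: fM; rewrite ax lexx.
have : `|f t - f x| < 1 by apply: ud => //; lra.
have := ler_normD (f t - f x) (f x); rewrite subrK.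
lra.
Qed.

Lemma lipschitz_ac a b f L : 0 <= L ->
  (forall x y, a <= x -> x <= y -> y <= b -> `|f y - f x| <= L * (y - x)) ->
  absolutely_continuous a b f.
Proof.
move=> L0 fL eps eps0; exists (eps / (L + 1)); first by rewrite divr_gt0//; lra.
move=> n x y xy tI; rewrite ltr_pdivlMr ?ltr_wpDl// => xyL.
apply: (@le_lt_trans _ _ ((\sum_(i < n) (y i - x i)) * (L + 1))) => //.
rewrite mulr_suml; apply: ler_sum => i _; have [ax xyi yb] := xy i.
apply: (le_trans (fL _ _ ax xyi yb)); rewrite mulrC ler_wpM2l// ?subr_ge0//; lra.
Qed.

Lemma acB a b f g : absolutely_continuous a b f -> absolutely_continuous a b g ->
  absolutely_continuous a b (fun t => f t - g t).
Proof.
move=> acf acg eps eps0; have e20 : 0 < eps / 2 by rewrite divr_gt0.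
have [d1 d10 H1] := acf _ e20; have [d2 d20 H2] := acg _ e20.
exists (Num.min d1 d2); first by rewrite lt_min d10.
move=> n x y xy tI; rewrite lt_min => /andP[xyd1 xyd2].
have := H1 n x y xy tI xyd1; have := H2 n x y xy tI xyd2.
have : \sum_(i < n) `|f (y i) - g (y i) - (f (x i) - g (x i))| <=
  \sum_(i < n) `|f (y i) - f (x i)| + \sum_(i < n) `|g (y i) - g (x i)|.
  rewrite -big_split/=; apply: ler_sum => i _.
  rewrite -[X in _ <= _ + X]normrN; apply: le_trans (ler_normD _ _).
  by rewrite le_eqVlt; apply/orP; left; apply/eqP; congr `|_|; ring.
lra.
Qed.

Lemma acM a b f g : absolutely_continuous a b f -> absolutely_continuous a b g ->
  absolutely_continuous a b (fun t => f t * g t).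
Proof.
move=> acf acg.
have [M M0 fM] := ac_bounded acf; have [N N0 gN] := ac_bounded acg.
move=> eps eps0; pose K := M + N + 1.
have K0 : 0 < K by rewrite /K; lra.
have e20 : 0 < eps / 2 / K by rewrite !divr_gt0.
have [d1 d10 H1] := acf _ e20; have [d2 d20 H2] := acg _ e20.
exists (Num.min d1 d2); first by rewrite lt_min d10.
move=> n x y xy tI; rewrite lt_min => /andP[xyd1 xyd2].
have {}H1 := H1 n x y xy tI xyd1; have {}H2 := H2 n x y xy tI xyd2.
rewrite ltr_pdivlMr// in H1; rewrite ltr_pdivlMr// in H2.
suff : \sum_(i < n) `|f (y i) * g (y i) - f (x i) * g (x i)| <=
  \sum_(i < n) `|f (y i) - f (x i)| * K + \sum_(i < n) `|g (y i) - g (x i)| * K.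
  by rewrite -!mulr_suml; lra.
rewrite -big_split/=; apply: ler_sum => i _; have [ax xyi yb] := xy i.
have -> : f (y i) * g (y i) - f (x i) * g (x i) =
  (f (y i) - f (x i)) * g (y i) + (g (y i) - g (x i)) * f (x i) by ring.
apply: (le_trans (ler_normD _ _)); rewrite !normrM; apply: lerD.
- apply: ler_wpM2l => //; apply: (@le_trans _ _ N); last by rewrite /K; lra.
  by apply: gN; rewrite yb (le_trans ax).
- apply: ler_wpM2l => //; apply: (@le_trans _ _ M); last by rewrite /K; lra.
  by apply: fM; rewrite ax (le_trans xyi).
Qed.

Lemma ac_cst a b (c : R) : absolutely_continuous a b (fun=> c).
Proof.
by apply: (@lipschitz_ac _ _ _ 0) => // x y _ _ _; rewrite subrr normr0 mul0r.
Qed.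

Lemma ac_expR a b (c : R) : absolutely_continuous a b (fun t => expR (c * t)).
Proof.
pose B := expR (`|c| * (`|a| + `|b|)).
have B0 : 0 < B by exact: expR_gt0.
apply: (@lipschitz_ac _ _ _ (`|c| * B)); first by rewrite mulr_ge0// ltW.
have e_le (u v : R) : u <= v -> expR v - expR u <= expR v * (v - u).
  move=> uv; have := expR_ge1Dx (u - v); rewrite expRD expRN => H.
  have : expR v * (1 + (u - v)) <= expR v * (expR u / expR v).
    by rewrite ler_wpM2l// ltW// expR_gt0.
  by rewrite mulrCA divff ?gt_eqF ?expR_gt0//; lra.
have eB t : a <= t -> t <= b -> expR (c * t) <= B.
  move=> at_ tb; rewrite ler_expR (le_trans (ler_norm _))// normrM ler_wpM2l//.
  have := ler_norm a; have := ler_norm b; have := ler_norm (- a).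
  have := ler_norm (- b); rewrite !normrN.
  have [t0|t0] := leP 0 t; [rewrite ger0_norm | rewrite ltr0_norm] => //; lra.
move=> x y ax xy yb.
have xB := eB x ax (le_trans xy yb); have yB := eB y (le_trans ax xy) yb.
have [c0|c0] := ltP c 0.
  rewrite distrC (ltr0_norm c0).
  have cxy : c * y <= c * x by rewrite ler_wnM2l// ltW.
  rewrite ger0_norm ?subr_ge0 ?ler_expR//.
  apply: (le_trans (e_le _ _ cxy)).
  have -> : - c * B * (y - x) = B * (c * x - c * y) by ring.
  by rewrite ler_wpM2r// subr_ge0.
have cxy : c * x <= c * y by rewrite ler_wpM2l.
rewrite (ger0_norm c0) ger0_norm ?subr_ge0 ?ler_expR//.
apply: (le_trans (e_le _ _ cxy)).
have -> : c * B * (y - x) = B * (c * y - c * x) by ring.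
by rewrite ler_wpM2r// subr_ge0.
Qed.

End ac_algebra.

(** * Bounded measurable functions *)

Section integral_tools.
Context {R : realType}.
Local Notation mu := (@lebesgue_measure R).
Implicit Types (f g z : R -> R) (a b M : R).

Lemma between_ge0 M (x : R) : 0 <= x <= M -> 0 <= M.
Proof. by move=> /andP[]; exact: le_trans. Qed.

Lemma bounded_integrable a b M f : measurable_fun `[a, b] f ->
  (forall t, a <= t <= b -> `|f t| <= M) -> mu.-integrable `[a, b] (EFin \o f).
Proof.
move=> mf fM; apply: measurable_bounded_integrable => //.
  by rewrite /= lebesgue_measure_itv/=; case: ifP => // _; rewrite -EFinB ltry.
exists M; split; first exact: num_real.
by move=> N MN t /=; rewrite in_itv/= => /fM /le_trans; apply; exact: ltW.
Qed.

Lemma bounded_cvg_Rintegral a b M (f_ : nat -> R -> R) f :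
  (forall n, measurable_fun `[a, b] (f_ n)) -> measurable_fun `[a, b] f ->
  (forall n t, a <= t <= b -> `|f_ n t| <= M) ->
  {ae mu, forall t, a <= t <= b -> f_ n t @[n --> \oo] --> f t} ->
  \int[mu]_(t in `[a, b]) f_ n t @[n --> \oo] --> \int[mu]_(t in `[a, b]) f t.
Proof.
move=> mf_ mf fM ff.
have [] := @dominated_convergence _ _ _ mu `[a, b] _ (fun n => EFin \o f_ n)
  (EFin \o f) (cst M%:E).
- exact: measurable_itv.
- by move=> n; apply/measurable_EFinP; exact: mf_.
- by apply/measurable_EFinP; exact: mf.
- apply: (aeS ff) => t H; rewrite /= in_itv/= => /H.
  by move=> ?; apply: cvg_EFin => //; exact: nearW.
- by apply: (@bounded_integrable _ _ `|M|) => //; exact: measurable_cst.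
- by apply: aeW => t n /=; rewrite in_itv/= => /fM; rewrite lee_fin; exact.
move=> fi _ H; rewrite /Rintegral; apply: fine_cvg.
rewrite fineK; first exact: H.
exact: integrable_fin_num.
Qed.

Lemma ae_eq_Rintegral a b f g : measurable_fun `[a, b] f -> measurable_fun `[a, b] g ->
  {ae mu, forall t, a <= t <= b -> f t = g t} ->
  \int[mu]_(t in `[a, b]) f t = \int[mu]_(t in `[a, b]) g t.
Proof.
move=> mf mg fg; congr fine; apply: ae_eq_integral => //.
- by apply/measurable_EFinP; exact: mf.
- by apply/measurable_EFinP; exact: mg.
- by apply: (aeS fg) => t H; rewrite /= in_itv/= => /H ->.
Qed.

(** One measurable function serves as the limit at every point where the
    sequence converges: the upper limit, which is measurable, truncated to
    [[0, M]]. *)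
Lemma bounded_limit M (f_ : nat -> R -> R) :
  (forall n, measurable_fun setT (f_ n)) ->
  (forall n t, 0 <= f_ n t <= M) ->
  exists f, [/\ measurable_fun setT f, forall t, 0 <= f t <= M &
    forall t l, f_ n t @[n --> \oo] --> l -> f t = l].
Proof.
move=> mf fM.
pose f t := Num.min M (Num.max 0 (limn_sup (f_ ^~ t))).
have M0 : 0 <= M by exact: between_ge0 (fM 0%N 0).
exists f; split.
- apply: measurable_minr; first exact: measurable_cst.
  apply: measurable_maxr; first exact: measurable_cst.
  apply: measurable_fun_limn_sup => //.
  + by move=> t _; exists M => _ [n _ <-]; have /andP[] := fM n t.
  + by move=> t _; exists 0 => _ [n _ <-]; have /andP[] := fM n t.
- by move=> t; rewrite /f le_min M0 le_max lexx ge_min lexx.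
- move=> t l fl; rewrite /f (cvg_limn_inf_sup fl).2 max_r ?min_r//.
    by apply: (cvgr_to_le fl); apply: nearW => n; have /andP[] := fM n t.
  by apply: (cvgr_to_ge fl); apply: nearW => n; have /andP[] := fM n t.
Qed.

Lemma indefinite_integral_itv a M z x y : measurable_fun setT z ->
  (forall t, 0 <= z t <= M) -> a <= x -> x <= y ->
  0 <= \int[mu]_(t in `[a, y]) z t - \int[mu]_(t in `[a, x]) z t <= M * (y - x).
Proof.
move=> mz zM ax xy.
have zi u v : mu.-integrable `[u, v] (EFin \o z).
  apply: (@bounded_integrable _ _ M); first exact: measurable_funS mz.
  by move=> t _; rewrite ger0_norm; have /andP[] := zM t.
rewrite (@Rintegral_itvB _ _ (BLeft a) (BRight y) x) ?bnd_simp//.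
rewrite Rintegral_ge0 /=; last by move=> t _; have /andP[] := zM t.
rewrite Rintegral_itv_obnd_cbnd; last first.
  by apply: integrableS (zi x y) => //; exact: subset_itv_oc_cc.
have -> : M * (y - x) = \int[mu]_(t in `[x, y]) M.
  rewrite Rintegral_cst//= lebesgue_measure_itv/= lte_fin.
  by case: ltgtP xy => //= -> _; rewrite subrr.
apply: le_Rintegral => //.
  apply: (@bounded_integrable _ _ M); first exact: measurable_cst.
  by move=> t _; rewrite ger0_norm//; exact: between_ge0 (zM t).
by move=> t _; have /andP[] := zM t.
Qed.

Lemma indefinite_integral_derive a M z : measurable_fun setT z ->
  (forall t, 0 <= z t <= M) ->
  {ae mu, forall t, a < t ->
     is_derive t 1 (fun x => \int[mu]_(u in `[a, x]) z u) (z t)}.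
Proof.
move=> mz zM.
have zi u v : mu.-integrable `[u, v] (EFin \o z).
  apply: (@bounded_integrable _ _ M); first exact: measurable_funS mz.
  by move=> t _; rewrite ger0_norm; have /andP[] := zM t.
have := @FTC1 R z (BLeft a) (zi a).
have lz : locally_integrable [set: R] z.
  split; [exact: mz|exact: openT|move=> K _ cK].
  have mK : measurable K by exact: compact_measurable.
  apply: (@le_lt_trans _ _ (M%:E * mu K)%E).
    apply: (@integral_le_bound _ _ _ mu K (EFin \o z) M%:E) => //.
    - by apply/measurable_EFinP; exact: measurable_funS mz.
    - by rewrite lee_fin; exact: between_ge0 (zM 0).
    - by apply: aeW => t _; rewrite lee_fin ger0_norm; have /andP[] := zM t.
  rewrite lte_mul_pinfty ?lee_fin//.
    exact: between_ge0 (zM 0).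
  exact: compact_finite_measure.
move=> /(_ lz) /aeS; apply => t H at_.
have [|dz Ez] := H; first by rewrite /= lte_fin.
by apply: DeriveDef; [exact: dz|rewrite -derive1E; exact: Ez].
Qed.
End integral_tools.

(** * Maximisation of quasiconcave functionals *)

Section strong_compactness.
Context {R : realType}.
Local Notation mu := (@lebesgue_measure R).
Variables (a b M : R).
Implicit Types (f g z : R -> R).

Lemma square_integrable f : measurable_fun setT f -> (forall t, `|f t| <= M) ->
  mu.-integrable `[a, b] (EFin \o (fun t => f t ^+ 2)).
Proof.
move=> mf fM; apply: (@bounded_integrable _ _ _ (M ^+ 2)).
  by apply: measurable_funX; exact: measurable_funS mf.
by move=> t _; rewrite normrX lerXn2r// ?nnegrE//; exact: le_trans (fM t).
Qed.

Lemma between_normB (x y : R) : 0 <= x <= M -> 0 <= y <= M -> `|x - y| <= M.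
Proof. by move=> /andP[x0 xM] /andP[y0 yM]; rewrite ler_norml; lra. Qed.

Lemma sum_half_powers n : \sum_(0 <= i < n) 2^-1 ^+ i <= 2 :> R.
Proof.
suff -> : \sum_(0 <= i < n) 2^-1 ^+ i = 2 - 2 * 2^-1 ^+ n :> R.
  by rewrite gerBl mulr_ge0// exprn_ge0// invr_ge0.
elim: n => [|n IH]; first by rewrite big_geq// expr0 mulr1 subrr.
by rewrite big_nat_recr//= IH exprS; field.
Qed.

(** A sequence that is Cauchy in [L^2] at a geometric rate converges almost
    everywhere. *)
Lemma fast_cauchy_cvg_ae (w : nat -> R -> R) :
  (forall n, measurable_fun setT (w n)) -> (forall n t, 0 <= w n t <= M) ->
  (forall n, \int[mu]_(t in `[a, b]) (w n.+1 t - w n t) ^+ 2 <= 4^-1 ^+ n) ->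
  {ae mu, forall t, a <= t <= b -> cvgn (w ^~ t)}.
Proof.
move=> mw wM wd.
pose d n t := w n.+1 t - w n t.
have md n : measurable_fun setT (d n) by exact: measurable_funB.
have di n : mu.-integrable `[a, b] (EFin \o (fun t => d n t ^+ 2)).
  by apply: square_integrable => // t; exact: between_normB.
(* The weight [2 ^+ n] keeps the series of the integrals convergent, by the rate
   [4^-1 ^+ n], and dominates [`|d n t|] up to the summable [2^-1 ^+ n]. *)
pose h n t : \bar R := (2 ^+ n * d n t ^+ 2)%:E.
have h0 n t : (0 <= h n t)%E by rewrite lee_fin; apply: mulr_ge0; [exact: exprn_ge0|exact: sqr_ge0].
have mh n : measurable_fun `[a, b] (h n).
  apply/measurable_EFinP; apply: measurable_funM; first exact: measurable_cst.
  by apply: measurable_funX; exact: measurable_funS (md n).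
have hi n : (\int[mu]_(t in `[a, b]) h n t <= (2^-1 ^+ n)%:E)%E.
  have -> : (\int[mu]_(t in `[a, b]) h n t =
      (2 ^+ n * \int[mu]_(t in `[a, b]) d n t ^+ 2)%:E)%E.
    rewrite -RintegralZl// /Rintegral fineK//.
    apply: integrable_fin_num => //.
    apply: eq_integrable (integrableZl _ (2 ^+ n) (di n)) => //.
  rewrite lee_fin (le_trans (ler_wpM2l _ (wd n))) ?exprn_ge0//.
  rewrite -exprMn; have -> : 2 * 4^-1 = 2^-1 :> R by field.
  by [].
have sumh : (\int[mu]_(t in `[a, b]) (\sum_(0 <= n <oo) h n t) < +oo)%E.
  rewrite integral_nneseries//.
  apply: (@le_lt_trans _ _ (\sum_(0 <= n <oo) (2^-1 ^+ n)%:E)%E).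
    by apply: lee_nneseries => [n _ _|n _]; [exact: integral_ge0|exact: hi].
  apply: (@le_lt_trans _ _ 2%:E); last exact: ltry.
  have := @epsilon_trick0 R 2 xpredT (ler0n R 2).
  apply: le_trans; apply: lee_nneseries => [n _ _|n _].
    by rewrite lee_fin exprn_ge0// invr_ge0.
  by rewrite lee_fin natrX exprS invfM mulrA divff// mul1r exprVn.
have : {ae mu, forall t, `[a, b]%classic t -> (\sum_(0 <= n <oo) h n t)%E \is a fin_num}.
  apply: integrable_ae => //; apply/integrableP; split.
    by apply: ge0_emeasurable_sum => [n t _ _|n _]; [exact: h0|exact: mh].
  under eq_integral do rewrite gee0_abs ?nneseries_ge0//.
  exact: sumh.
move=> /aeS; apply => t + tab; rewrite /= in_itv/= tab => /(_ isT).
set s := (X in X \is a fin_num) => sfin.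
have cd : cvgn (series (fun n => `|d n t|)).
  apply: nondecreasing_is_cvgn.
    by apply: nondecreasing_series => n _ _.
  exists (fine s + 2) => _ [n _ <-].
  apply: (@le_trans _ _ (\sum_(0 <= i < n) (2 ^+ i * d i t ^+ 2 + 2^-1 ^+ i))).
    apply: ler_sum => i _; rewrite -[d i t ^+ 2]real_normK ?num_real//.
    set x := `|d i t|; set p := 2 ^+ i.
    have p0 : 0 < p by rewrite exprn_gt0.
    have -> : 2^-1 ^+ i = p^-1 by rewrite exprVn.
    have : 0 <= p * (x - p^-1 / 2) ^+ 2 by rewrite mulr_ge0 ?sqr_ge0// ltW.
    have -> : p * (x - p^-1 / 2) ^+ 2 = p * x ^+ 2 - x + p^-1 / 4.
      by field; rewrite gt_eqF.
    have : 0 < p^-1 by rewrite invr_gt0.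
    lra.
  rewrite big_split/= lerD ?sum_half_powers// -lee_fin fineK// -sumEFin.
  by apply: nneseries_lim_ge => i _ _; exact: h0.
have : cvgn (series (d ^~ t)) by exact: normed_cvg.
have -> : w ^~ t = (fun n => w 0%N t + series (d ^~ t) n).
  apply/funext => n; rewrite /series/= /d telescope_sumr//.
  by rewrite addrC subrK.
by move=> dc; apply: is_cvgD => //; exact: is_cvg_cst.
Qed.

Section convex_maximisation.
Variables (Z : set (R -> R)) (J : (R -> R) -> R) (C : R).
Hypothesis Z_neq0 : Z !=set0.
Hypothesis Z_measurable : forall z, Z z -> measurable_fun setT z.
Hypothesis Z_between : forall z, Z z -> forall t, 0 <= z t <= M.
Hypothesis Z_mid : forall y z, Z y -> Z z -> Z (fun t => (y t + z t) / 2).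
Hypothesis J_mid : forall y z r, Z y -> Z z -> r <= J y -> r <= J z ->
  r <= J (fun t => (y t + z t) / 2).
Hypothesis J_ub : forall z, Z z -> J z <= C.
Hypothesis ZJ_closed : forall (w : nat -> R -> R) z, (forall n, Z (w n)) ->
  measurable_fun setT z -> (forall t, 0 <= z t <= M) ->
  {ae mu, forall t, a <= t <= b -> w n t @[n --> \oo] --> z t} ->
  exists2 y, Z y & J (w n) @[n --> \oo] --> J y.

Let N z := \int[mu]_(t in `[a, b]) z t ^+ 2.

Let N_ge0 z : 0 <= N z.
Proof. by apply: Rintegral_ge0 => t _; exact: sqr_ge0. Qed.

(** The parallelogram identity, with the midpoint in place of the sum. *)
Let parallelogram y z : Z y -> Z z ->
  \int[mu]_(t in `[a, b]) (y t - z t) ^+ 2 =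
  2 * N y + 2 * N z - 4 * N (fun t => (y t + z t) / 2).
Proof.
move=> Zy Zz.
have ZM x : Z x -> forall t, `|x t| <= M.
  by move=> Zx t; rewrite ger0_norm; have /andP[] := Z_between Zx t.
have iy := square_integrable (Z_measurable Zy) (ZM _ Zy).
have iz := square_integrable (Z_measurable Zz) (ZM _ Zz).
have im := square_integrable (Z_measurable (Z_mid Zy Zz)) (ZM _ (Z_mid Zy Zz)).
have scal k x : mu.-integrable `[a, b] (EFin \o x) ->
    mu.-integrable `[a, b] (EFin \o (fun t => k * x t)).
  by move=> ix; apply: eq_integrable (integrableZl _ k ix).
have add x u : mu.-integrable `[a, b] (EFin \o x) ->
    mu.-integrable `[a, b] (EFin \o u) ->
    mu.-integrable `[a, b] (EFin \o (fun t => x t + u t)).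
  by move=> ix iu; apply: eq_integrable (integrableD _ ix iu).
rewrite /N -!RintegralZl//.
rewrite -RintegralD//; [|exact: scal..].
rewrite -RintegralB//; [|exact: add (scal _ _ iy) (scal _ _ iz)|exact: scal].
by apply: eq_Rintegral => t _; field.
Qed.

(** Quasiconcavity is only used at midpoints. In [ZJ_closed] the limit [y] may
    differ from [z], typically on a null set. *)
Lemma quasiconcave_attains_max : exists2 z, Z z & forall y, Z y -> J y <= J z.
Proof.
have [z0 Zz0] := Z_neq0.
have supJ : has_sup (J @` Z).
  by split; [exists (J z0); exists z0|exists C => _ [z Zz <-]; exact: J_ub].
pose S := sup (J @` Z).
have JS y : Z y -> J y <= S by move=> Zy; apply: ub_le_sup; [exact: supJ.2|exists y].
pose K n := [set z | Z z /\ S - n.+1%:R^-1 <= J z].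
have K_neq0 n : K n !=set0.
  have [|_ [z Zz <-] Jz] := @sup_adherent _ (J @` Z) n.+1%:R^-1 _ supJ.
    by rewrite invr_gt0.
  by exists z; split => //; exact: ltW.
have K_nincr m n : (m <= n)%N -> K n `<=` K m.
  move=> mn z [Zz Jz]; split => //; apply: le_trans Jz.
  by rewrite lerD2l lerN2 lef_pV2 ?posrE// ler_nat.
pose r n := inf (N @` K n).
have infN n : has_inf (N @` K n).
  split; last by exists 0 => _ [z _ <-]; exact: N_ge0.
  by have [z Kz] := K_neq0 n; exists (N z); exists z.
have rN n z : K n z -> r n <= N z.
  by move=> Kz; apply: ge_inf; [exact: (infN n).2|exists z].
have r_nd : nondecreasing_seq r.
  move=> m n mn; apply: lb_le_inf; first exact: (infN n).1.
  move=> _ [z Kz <-].  by apply: rN; exact: K_nincr Kz.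
have [z Kz Nz] : exists2 z : nat -> R -> R, (forall n, K n (z n)) &
    forall n, N (z n) < r n + n.+1%:R^-1.
  have H n : exists z, K n z /\ N z < r n + n.+1%:R^-1.
    have [|_ [z Kz <-] Nz] := @inf_adherent _ (N @` K n) n.+1%:R^-1 _ (infN n).
      by rewrite invr_gt0.
    by exists z.
  by have [z zH] := choice H; exists z => n; have [] := zH n.
have r_cvg : cvgn r.
  apply: (nondecreasing_is_cvgn r_nd).
  exists (\int[mu]_(t in `[a, b]) M ^+ 2) => _ [n _ <-].
  apply: (le_trans (rN _ _ (Kz n))).
  have ZM t : `|z n t| <= M.
    by rewrite ger0_norm; have /andP[] := Z_between (Kz n).1 t.
  apply: le_Rintegral => //.
  - exact: square_integrable (Z_measurable (Kz n).1) ZM.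
  - apply: square_integrable => // t; rewrite ger0_norm//.
    exact: between_ge0 (Z_between Zz0 t).
  - move=> t _; rewrite -[z n t ^+ 2]real_normK ?num_real//.
    by rewrite lerXn2r// nnegrE//; exact: le_trans (ZM t).
have [l rl r_le] : exists2 l : R, r n @[n --> \oo] --> l & forall n, r n <= l.
  by exists (limn r) => // n; exact: nondecreasing_cvgn_le.
have z_cauchy m n : (m <= n)%N ->
    \int[mu]_(t in `[a, b]) (z n t - z m t) ^+ 2 <=
    2 * (l - r m) + 4 * m.+1%:R^-1.
  move=> mn; rewrite parallelogram; [|exact: (Kz n).1|exact: (Kz m).1].
  have : r m <= N (fun t => (z n t + z m t) / 2).
    apply: rN; have [Zn Jn] := K_nincr _ _ mn _ (Kz n).
    have [Zm Jm] := Kz m.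
    by split; [exact: Z_mid|exact: J_mid].
  have := Nz n; have := Nz m; have := r_le n.
  have : n.+1%:R^-1 <= m.+1%:R^-1 :> R by rewrite lef_pV2 ?posrE// ler_nat.
  move: (N _) (N _) (N _) (r m) (r n) (n.+1%:R^-1) (m.+1%:R^-1) => ? ? ? ? ? ? ?.
  lra.
have z_small e : 0 < e -> exists m0, forall m n, (m0 <= m)%N -> (m <= n)%N ->
    \int[mu]_(t in `[a, b]) (z n t - z m t) ^+ 2 <= e.
  move=> e0.
  have : 2 * (l - r m) + 4 * m.+1%:R^-1 @[m --> \oo] --> (0 : R).
    rewrite [X in _ --> X](_ : 0 = 2 * (l - l) + 4 * 0); last by ring.
    apply: cvgD; first by apply: cvgMr; apply: cvgB => //; exact: cvg_cst.
    by apply: cvgMr; exact: cvg_harmonic.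
  move=> /cvgr_le /(_ _ e0) [m0 _ H]; exists m0 => m n m0m mn.
  exact: le_trans (z_cauchy _ _ mn) (H _ m0m).
(* [w j = z (psi j)] is a subsequence along which consecutive [L^2] distances
   decay geometrically; the summand [j] in [psi j] makes [psi j >= j]. *)
have [phi phiP] : exists phi : nat -> nat, forall j m n,
    (phi j <= m)%N -> (m <= n)%N ->
    \int[mu]_(t in `[a, b]) (z n t - z m t) ^+ 2 <= 4^-1 ^+ j.
  have H j : exists m0, forall m n, (m0 <= m)%N -> (m <= n)%N ->
    \int[mu]_(t in `[a, b]) (z n t - z m t) ^+ 2 <= 4^-1 ^+ j.
    by apply: z_small; rewrite exprn_gt0// invr_gt0.
  by have [phi phiP] := choice H; exists phi.
pose psi j := (j + \sum_(0 <= i < j.+1) phi i)%N.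
have psi_phi j : (phi j <= psi j)%N.
  by rewrite /psi big_nat_recr//= addnA leq_addl.
have psi_S j : (psi j <= psi j.+1)%N.
  by rewrite /psi [in leqRHS]big_nat_recr//= leq_add// leq_addr.
pose w j := z (psi j).
have Zw j : Z (w j) by exact: (Kz _).1.
have [f [mf fM fE]] := bounded_limit (fun j => Z_measurable (Zw j))
  (fun j => Z_between (Zw j)).
have w_ae : {ae mu, forall t, a <= t <= b -> cvgn (w ^~ t)}.
  apply: fast_cauchy_cvg_ae => [n|n|n]; first exact: Z_measurable.
    exact: Z_between.
  exact: (phiP n).
have [y Zy Jy] : exists2 y, Z y & J (w n) @[n --> \oo] --> J y.
  apply: (ZJ_closed Zw mf fM); apply: (aeS w_ae) => t H /H {}H.
  by rewrite (fE _ _ H).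
exists y => // x Zx; apply: (le_trans (JS _ Zx)).
have SJ : S - n.+1%:R^-1 @[n --> \oo] --> S.
  rewrite -[X in _ --> X]subr0; apply: cvgB; first exact: cvg_cst.
  exact: cvg_harmonic.
apply: (ler_cvg_to SJ Jy); apply: nearW => n.
apply: le_trans (Kz (psi n)).2; rewrite lerD2l lerN2 lef_pV2 ?posrE//.
by rewrite ler_nat ltnS leq_addr.
Qed.

End convex_maximisation.
End strong_compactness.

(** * Concavity and continuity of powers *)

Section powR_facts.
Context {R : realType}.
Implicit Types (p x y : R).

(** Midpoint concavity of [x `^ p] for [p <= 1], from the convexity of the
    inverse function [x `^ p^-1]. *)
Lemma powR_midpoint p x y : 0 < p <= 1 -> 0 <= x -> 0 <= y ->
  (x `^ p + y `^ p) / 2 <= ((x + y) / 2) `^ p.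
Proof.
move=> /andP[p0 p1] x0 y0.
have q1 : 1 <= p^-1 by rewrite invf_ge1.
have m0 : 0 <= (x `^ p + y `^ p) / 2 by rewrite divr_ge0// addr_ge0// powR_ge0.
have powK u : 0 <= u -> (u `^ p) `^ p^-1 = u.
  by move=> u0; rewrite -powRrM divff ?gt_eqF// powRr1.
have h0 : 0 <= 2^-1 :> R by lra.
have h1 : 2^-1 <= 1 :> R by lra.
have := @convex_powR R p^-1 q1 (Itv01 h0 h1) (x `^ p) (y `^ p).
rewrite !inE/= !in_itv/= !andbT !powR_ge0 => /(_ isT isT).
rewrite !convRE/= !powK// => H.
have {H} : ((x `^ p + y `^ p) / 2) `^ p^-1 <= (x + y) / 2.
  apply: le_trans (le_trans H _); last by rewrite /unstable.onem; lra.
  have -> : (x `^ p + y `^ p) / 2 = 2^-1 * x `^ p + (1 - 2^-1) * y `^ p by field.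
  exact: lexx.
move=> /(ge0_ler_powR (ltW p0)); rewrite !nnegrE powR_ge0.
rewrite divr_ge0 ?addr_ge0// => /(_ isT isT).
by rewrite -powRrM mulVf ?gt_eqF// powRr1.
Qed.

Lemma powR_le1D p x : 0 < p <= 1 -> 0 <= x -> x `^ p <= 1 + x.
Proof.
move=> /andP[p0 p1] x0; have [x1|x1] := leP x 1.
  have : x `^ p <= 1 `^ p by rewrite ge0_ler_powR ?nnegrE// ltW.
  by rewrite powR1; lra.
by rewrite (le_trans (ler1_powR _ p1)) ?ltW// ltrDr.
Qed.

(** Nonnegativity of the sequence matters when [l = 0]: negative numbers have
    power [1]. *)
Lemma cvg_powR p (u : nat -> R) l : 0 < p -> (forall n, 0 <= u n) ->
  u n @[n --> \oo] --> l -> u n `^ p @[n --> \oo] --> l `^ p.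
Proof.
move=> p0 u0 ul.
have l0 : 0 <= l by apply: (cvgr_to_ge ul); exact: nearW.
have [lE|ln0] := eqVneq l 0.
  rewrite lE powR0 ?gt_eqF//; apply/cvgrPdist_le => e e0.
  have e'0 : 0 < e `^ p^-1 by exact: powR_gt0.
  move: ul; rewrite lE => /cvgr_le /(_ _ e'0).
  apply: filterS => n une; rewrite sub0r normrN ger0_norm ?powR_ge0//.
  have : u n `^ p <= (e `^ p^-1) `^ p.
    by rewrite ge0_ler_powR ?nnegrE// ltW.
  by rewrite -powRrM mulVf ?gt_eqF// powRr1// ltW.
have {ln0}l0 : 0 < l by rewrite lt_neqAle eq_sym ln0.
have : expR (p * ln (u n)) @[n --> \oo] --> l `^ p.
  rewrite /powR gt_eqF//; apply: continuous_cvg; first exact: continuous_expR.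
  apply: cvgMr; apply: continuous_cvg => //; exact: continuous_ln.
apply: cvg_trans; apply: near_eq_cvg.
near=> n; rewrite /powR gt_eqF//.
near: n; exact: cvgr_gt ul _ l0.
Unshelve. all: by end_near. Qed.

End powR_facts.

(** * Absolutely continuous functions as integrals *)

Section ac_integral.
Context {R : realType}.
Local Notation mu := (@lebesgue_measure R).
Implicit Types (a b M : R) (f z : R -> R).

Lemma ac_sub a b c d f : a <= c -> d <= b -> absolutely_continuous a b f ->
  absolutely_continuous c d f.
Proof.
move=> ac db acf eps /acf [delta d0 H]; exists delta => // n x y xy.
by apply: H => i; have [cx xyi yd] := xy i; split => //;
  [exact: le_trans cx|exact: le_trans db].
Qed.

Lemma ae_neq a : {ae mu, forall t, t <> a}.
Proof.
exists [set a]; split; [exact: measurable_set1|exact: lebesgue_measure_set1|].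
by move=> t /= /contrapT ->.
Qed.

Lemma ac_indefinite_integral a b M z : measurable_fun setT z ->
  (forall t, 0 <= z t <= M) ->
  absolutely_continuous a b (fun t => \int[mu]_(u in `[a, t]) z u).
Proof.
move=> mz zM; apply: (lipschitz_ac (between_ge0 (zM 0))) => x y ax xy yb.
have /andP[I0 IM] := indefinite_integral_itv mz zM ax xy.
by rewrite ger0_norm.
Qed.

(** Fundamental theorem of calculus, for an absolutely continuous function with
    bounded nonnegative Borel derivative. *)
Lemma ac_eq_integral a b M z f : absolutely_continuous a b f ->
  measurable_fun setT z -> (forall t, 0 <= z t <= M) ->
  {ae mu, forall t, a <= t <= b -> is_derive t 1 f (z t)} ->
  forall t, a <= t <= b -> f t = f a + \int[mu]_(u in `[a, t]) z u.
Proof.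
move=> acf mz zM fz t /andP[at_ tb].
pose I x := \int[mu]_(u in `[a, x]) z u.
have acI : absolutely_continuous a b I by exact: ac_indefinite_integral mz zM.
have Ia : I a = 0 by rewrite /I set_itv1 Rintegral_set1.
have dI : {ae mu, forall x, a <= x <= t ->
    is_derive x 1 f (z x) /\ is_derive x 1 I (z x)}.
  have := aeS2 fz (indefinite_integral_derive a mz zM) (fun x H H' => conj H H').
  move=> /(aeS2 (ae_neq a)); apply => x xa [H H'] /andP[ax xt].
  split; first by apply: H; rewrite ax (le_trans xt).
  by apply: H'; rewrite lt_neqAle ax andbT; apply/eqP => /esym.
have H1 : f t - I t <= f a - I a.
  apply: (ac_nonincreasing at_ (ac_sub (lexx a) tb (acB acf acI))).
  apply: (aeS dI) => x H /H [dfx dIx]; exists (z x - z x); first by rewrite subrr.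
  exact: is_deriveB.
have H2 : I t - f t <= I a - f a.
  apply: (ac_nonincreasing at_ (ac_sub (lexx a) tb (acB acI acf))).
  apply: (aeS dI) => x H /H [dfx dIx]; exists (z x - z x); first by rewrite subrr.
  exact: is_deriveB.
by rewrite -/(I t); lra.
Qed.

(** The projection of the line onto the segment [[a, b]]. *)
Definition clamp a b (t : R) := Num.max a (Num.min t b).

Lemma clamp_id a b t : a <= t <= b -> clamp a b t = t.
Proof. by move=> /andP[at_ tb]; rewrite /clamp (min_idPl tb) (max_idPr at_). Qed.

Lemma clamp_between a b t : a <= b -> a <= clamp a b t <= b.
Proof. by move=> ab; rewrite /clamp le_max lexx/= ge_max ab ge_min lexx orbT. Qed.

Lemma measurable_clamp a b f : a <= b -> absolutely_continuous a b f ->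
  measurable_fun setT (fun t => f (clamp a b t)).
Proof.
move=> ab acf; apply: continuous_measurable_fun => t.
apply/cvgrPdist_lt => e e0; have [d d0 H] := ac_uniform acf e0.
have clamp_lip u v : v <= u -> clamp a b v <= clamp a b u /\
    clamp a b u - clamp a b v <= u - v.
  move=> vu; rewrite /clamp.
  case: (leP u b) => ub; case: (leP v b) => vb; rewrite ?(max_idPr ab);
  case: (leP a u) => au; case: (leP a v) => av; split; lra.
have H' u v : `|u - v| < d -> `|f (clamp a b u) - f (clamp a b v)| < e.
  wlog uv : u v / v <= u => [W|].
    have [|uv] := leP v u; first exact: W.
    by rewrite distrC => /W; rewrite distrC; apply; exact: ltW.
  have /andP[au ub] := clamp_between u ab.
  have /andP[av vb] := clamp_between v ab.
  rewrite ger0_norm ?subr_ge0// => uvd; apply: H => //.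
    by apply: (clamp_lip _ _ uv).1.
  exact: le_lt_trans (clamp_lip _ _ uv).2 uvd.
exists d => //= u; exact: H'.
Qed.

End ac_integral.

(** * The Borel and the completed Lebesgue measure *)

Section completed.
Context {R : realType}.
Local Notation mu := (@lebesgue_measure R).
Local Notation cmu := (@completed_lebesgue_measure R).

(** Both measures are restrictions of one outer measure, and a set of outer
    measure zero is contained in a Borel null set. *)
Lemma ae_completed (P : R -> Prop) :
  {ae cmu, forall t, P t} <-> {ae mu, forall t, P t}.
Proof.
split => [[N [mN N0 PN]]|[N [mN N0 PN]]].
- apply/negligible_outer_measure; apply/eqP; rewrite eq_le outer_measure_ge0.
  by rewrite andbT -N0; exact: le_outer_measure.
- exists N; split => //; exact: sub_caratheodory.
Qed.

Lemma measurable_lebesgue_type (f : R -> R) D : measurable_fun setT f ->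
  lebesgue_measurable_fun D f.
Proof.
move=> mf mD Y mY; apply: measurableI => //.
by apply: sub_caratheodory; rewrite -[X in measurable X]setTI; exact: mf.
Qed.

Lemma Rintegral_completed (f : R -> R) a b : measurable_fun setT f ->
  (forall t, 0 <= f t) ->
  \int[cmu]_(t in `[a, b]) f t = \int[mu]_(t in `[a, b]) f t.
Proof.
move=> mf f0; congr fine.
have mid : measurable_fun setT (idfun : lebesgue_type R -> R).
  by apply: (@measurable_lebesgue_type idfun setT); exact: measurable_id.
have <- := @ge0_integral_pushforward _ _ (lebesgue_type R) (measurableTypeR R) R
  idfun mid cmu `[a, b] (EFin \o f).
- exact: eq_measure_integral.
- exact: measurable_itv.
- by apply/measurable_EFinP; exact: measurable_funS mf.
- by move=> t _; rewrite lee_fin.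
Qed.
End completed.

(** * The scaled problem *)

Section scaled_problem.
Context {R : realType}.
Local Notation mu := (@lebesgue_measure R).
Variables (A t0 T lambda sigma k0 alpha beta M : R).
Hypothesis A_gt0 : 0 < A.
Hypothesis t0_ge0 : 0 <= t0.
Hypothesis t0_lt_T : t0 < T.
Hypothesis lambda_ge0 : 0 <= lambda.
Hypothesis sigma_gt0 : 0 < sigma.
Hypothesis k0_ge0 : 0 <= k0.
Hypothesis alpha_in : 0 < alpha <= 1.
Hypothesis beta_in : 0 < beta <= 1.
Hypothesis M_ge0 : 0 <= M.
Implicit Types (y z : R -> R) (t : R).

(** The capital [k], scaled by the integrating factor [expR (sigma * t)], when
    the scaled investment [z t = A * expR (sigma * t) * k t `^ alpha * s t] is
    taken as the control: then [z] is the derivative of the scaled capital. *)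
Definition scaled_capital z t :=
  expR (sigma * t0) * k0 + \int[mu]_(u in `[t0, t]) z u.

(** The factor that turns [K t `^ alpha], for the scaled capital [K], into the
    scaled production [A * expR (sigma * t) * k t `^ alpha]. *)
Definition gain t := A * expR (sigma * (1 - alpha) * t).

(** The largest possible value of the scaled investment at time [t]. *)
Definition capacity z t := gain t * scaled_capital z t `^ alpha.

(** The discount factor, together with the factor that turns the scaled
    consumption [capacity z t - z t] back into consumption. *)
Definition weight t := (A^-1 * expR (- sigma * t)) `^ beta * expR (- lambda * t).

(** The integrand of the objective, in terms of the scaled control. *)
Definition scaled_payoff z t := weight t * (capacity z t - z t) `^ beta.

(** The objective, in terms of the scaled control. *)
Definition value z := \int[mu]_(t in `[t0, T]) scaled_payoff z t.

(** The feasible scaled controls, taken Borel measurable on the whole line.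
    The bound [M] is stated separately; by Gronwall's inequality it is implied,
    for a suitable [M], by the other constraints. *)
Definition admissible z := [/\ measurable_fun setT z,
  forall t, 0 <= z t <= M & forall t, t0 <= t <= T -> z t <= capacity z t].

Let alpha_gt0 : 0 < alpha. Proof. by case/andP: alpha_in. Qed.
Let beta_gt0 : 0 < beta. Proof. by case/andP: beta_in. Qed.
Let t0_le_T : t0 <= T. Proof. exact: ltW. Qed.

Lemma scaled_capitalE z t : scaled_capital z t =
  expR (sigma * t0) * k0 + \int[mu]_(u in `[t0, t]) z u.
Proof. by []. Qed.

Lemma capacityE z t : capacity z t = gain t * scaled_capital z t `^ alpha.
Proof. by []. Qed.

Lemma gain_gt0 t : 0 < gain t.
Proof. by rewrite mulr_gt0// expR_gt0. Qed.

Lemma gain_le t : t <= T -> gain t <= gain T.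
Proof.
move=> tT; rewrite /gain (ler_wpM2l (ltW A_gt0))// ler_expR ler_wpM2l//.
by case/andP: alpha_in => _; rewrite -subr_ge0; apply: mulr_ge0; exact: ltW.
Qed.

Lemma weight_ge0 t : 0 <= weight t.
Proof. by rewrite mulr_ge0 ?powR_ge0// expR_ge0. Qed.

Lemma weight_le t : t0 <= t -> weight t <= A^-1 `^ beta.
Proof.
move=> /(le_trans t0_ge0) t_ge0.
have V0 : 0 <= A^-1 by rewrite invr_ge0 ltW.
have e1 c : 0 <= c -> expR (- c * t) <= 1.
  by move=> c0; rewrite -[leRHS]expR0 ler_expR mulNr oppr_le0 mulr_ge0.
rewrite /weight -[leRHS]mulr1; apply: ler_pM; rewrite ?powR_ge0 ?expR_ge0 ?e1//.
apply: ge0_ler_powR; rewrite ?nnegrE ?(ltW beta_gt0) ?mulr_ge0 ?expR_ge0//.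
by apply: ler_piMr => //; rewrite e1// ltW.
Qed.

Lemma scaled_capital_ge0 z t : (forall u, 0 <= z u) -> 0 <= scaled_capital z t.
Proof.
move=> z0; rewrite addr_ge0 ?mulr_ge0 ?expR_ge0//.
by apply: Rintegral_ge0 => u _.
Qed.

Lemma scaled_capital_t0 z : scaled_capital z t0 = expR (sigma * t0) * k0.
Proof. by rewrite /scaled_capital set_itv1 Rintegral_set1 addr0. Qed.

Section bounded_control.
Variable z : R -> R.
Hypothesis mz : measurable_fun setT z.
Hypothesis zM : forall t, 0 <= z t <= M.

Let z_ge0 t : 0 <= z t. Proof. by case/andP: (zM t). Qed.

Lemma control_integrable a b : mu.-integrable `[a, b] (EFin \o z).
Proof.
apply: (@bounded_integrable _ _ _ M); first exact: measurable_funS mz.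
by move=> t _; rewrite ger0_norm//; case/andP: (zM t).
Qed.

Lemma scaled_capital_ac : absolutely_continuous t0 T (scaled_capital z).
Proof.
move=> eps /(ac_indefinite_integral t0 T mz zM) [delta d0 H].
exists delta => // n x y xy tI xyd; apply: le_lt_trans (H n x y xy tI xyd).
by apply: ler_sum => i _; rewrite /scaled_capital opprD addrACA subrr add0r.
Qed.

Lemma scaled_capital_le t : t0 <= t <= T ->
  scaled_capital z t <= expR (sigma * t0) * k0 + M * (T - t0).
Proof.
move=> /andP[t0t tT]; rewrite lerD2l.
have /andP[_] := indefinite_integral_itv mz zM (lexx t0) t0t.
rewrite set_itv1 Rintegral_set1 subr0 => /le_trans; apply.
by rewrite ler_wpM2l// lerB.
Qed.

Lemma capacity_ge0 t : 0 <= capacity z t.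
Proof. by rewrite mulr_ge0 ?powR_ge0// ltW// gain_gt0. Qed.

(** A bound on the capacity, uniform in time and in the control. *)
Definition capacity_bound := gain T * (1 + (expR (sigma * t0) * k0 + M * (T - t0))).

Lemma capacity_le t : t0 <= t <= T -> capacity z t <= capacity_bound.
Proof.
move=> tT; rewrite ler_pM ?powR_ge0 ?(ltW (gain_gt0 t))//.
  by rewrite gain_le//; case/andP: tT.
rewrite (le_trans (powR_le1D alpha_in (scaled_capital_ge0 t z_ge0)))//.
by rewrite lerD2l scaled_capital_le.
Qed.

Lemma measurable_capacity : measurable_fun setT (fun t => capacity z (clamp t0 T t)).
Proof.
apply: measurable_funM.
  apply: (@measurable_clamp _ _ _ gain t0_le_T); apply: acM; first exact: ac_cst.
  exact: ac_expR.
apply: (@measurableT_comp _ _ _ _ _ _ (@powR R ^~ alpha)) => //.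
exact: measurable_clamp t0_le_T scaled_capital_ac.
Qed.

Lemma measurable_weight : measurable_fun setT weight.
Proof.
have mexp (c : R) : measurable_fun setT (fun t => expR (c * t)).
  apply: measurableT_comp; first exact: measurable_expR.
  by apply: measurable_funM; [exact: measurable_cst|exact: measurable_id].
apply: measurable_funM => //.
apply: (@measurableT_comp _ _ _ _ _ _ (@powR R ^~ beta)) => //.
by apply: measurable_funM => //; exact: measurable_cst.
Qed.

Lemma measurable_scaled_payoff : measurable_fun setT
  (fun t => weight t * (capacity z (clamp t0 T t) - z t) `^ beta).
Proof.
apply: measurable_funM; first exact: measurable_weight.
apply: (@measurableT_comp _ _ _ _ _ _ (@powR R ^~ beta)) => //.
by apply: measurable_funB => //; exact: measurable_capacity.
Qed.

Lemma measurable_scaled_payoff_itv : measurable_fun `[t0, T] (scaled_payoff z).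
Proof.
apply: (eq_measurable_fun (fun t =>
  weight t * (capacity z (clamp t0 T t) - z t) `^ beta)).
  by move=> t; rewrite inE/= in_itv/= => /clamp_id ->.
exact: measurable_funTS measurable_scaled_payoff.
Qed.

Hypothesis z_le : forall t, t0 <= t <= T -> z t <= capacity z t.

Lemma scaled_payoff_bounded t : t0 <= t <= T ->
  `|scaled_payoff z t| <= A^-1 `^ beta * capacity_bound `^ beta.
Proof.
move=> tT; rewrite ger0_norm ?mulr_ge0 ?weight_ge0 ?powR_ge0//.
rewrite ler_pM ?weight_ge0 ?powR_ge0 ?weight_le//; first by case/andP: tT.
have c0 : 0 <= capacity z t - z t by rewrite subr_ge0 z_le.
have cb : capacity z t - z t <= capacity_bound.
  by rewrite (le_trans _ (capacity_le tT))// gerBl.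
by rewrite ge0_ler_powR ?nnegrE ?(ltW beta_gt0)//; exact: le_trans cb.
Qed.

End bounded_control.

Lemma scaled_payoff_integrable z : admissible z ->
  mu.-integrable `[t0, T] (EFin \o scaled_payoff z).
Proof.
move=> [mz zM z_le]; apply: bounded_integrable.
  exact: measurable_scaled_payoff_itv mz zM.
exact: scaled_payoff_bounded mz zM z_le.
Qed.

Lemma admissible_neq0 : admissible !=set0.
Proof.
exists (fun=> 0); split; first exact: measurable_cst.
  by move=> t; rewrite lexx M_ge0.
by move=> t _; exact: capacity_ge0.
Qed.

Lemma scaled_capital_mid y z : admissible y -> admissible z -> forall t,
  scaled_capital (fun u => (y u + z u) / 2) t =
  (scaled_capital y t + scaled_capital z t) / 2.
Proof.
move=> [my yM _] [mz zM _] t; rewrite /scaled_capital.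
have iy := control_integrable my yM t0 t; have iz := control_integrable mz zM t0 t.
rewrite RintegralZr//; last by apply: eq_integrable (integrableD _ iy iz).
by rewrite RintegralD//; field.
Qed.

Lemma capacity_mid y z t : admissible y -> admissible z ->
  (capacity y t + capacity z t) / 2 <= capacity (fun u => (y u + z u) / 2) t.
Proof.
move=> Zy Zz; rewrite /capacity -mulrDr -mulrA ler_wpM2l ?(ltW (gain_gt0 t))//.
rewrite scaled_capital_mid//; apply: powR_midpoint => //.
  by case: Zy => _ yM _; apply: scaled_capital_ge0 => u; case/andP: (yM u).
by case: Zz => _ zM _; apply: scaled_capital_ge0 => u; case/andP: (zM u).
Qed.

Lemma admissible_mid y z : admissible y -> admissible z ->
  admissible (fun t => (y t + z t) / 2).
Proof.
move=> Zy Zz; have [my yM yc] := Zy; have [mz zM zc] := Zz; split.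
- by apply: measurable_funM => //; exact: measurable_funD.
- by move=> t; move: (y t) (z t) (yM t) (zM t) => yt zt; lra.
- move=> t tT; apply: le_trans (capacity_mid t Zy Zz).
  move: (capacity y t) (capacity z t) (y t) (z t) (yc t tT) (zc t tT) => cy cz yt zt.
  by lra.
Qed.

Lemma value_mid y z r : admissible y -> admissible z ->
  r <= value y -> r <= value z -> r <= value (fun t => (y t + z t) / 2).
Proof.
move=> Zy Zz ry rz; have [_ _ yc] := Zy; have [_ _ zc] := Zz.
have iy := scaled_payoff_integrable Zy; have iz := scaled_payoff_integrable Zz.
have iD : mu.-integrable `[t0, T]
    (EFin \o (fun t => scaled_payoff y t + scaled_payoff z t)).
  by apply: eq_integrable (integrableD _ iy iz).
apply: (@le_trans _ _ ((value y + value z) / 2)).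
  by move: (value y) (value z) ry rz => vy vz; lra.
have -> : (value y + value z) / 2 =
    \int[mu]_(t in `[t0, T]) ((scaled_payoff y t + scaled_payoff z t) / 2).
  rewrite RintegralZr; [|exact: measurable_itv|exact: iD].
  by rewrite RintegralD; [|exact: measurable_itv|exact: iy|exact: iz].
apply: le_Rintegral.
- exact: measurable_itv.
- by apply: eq_integrable (integrableZr _ 2^-1 iD).
- exact: scaled_payoff_integrable (admissible_mid Zy Zz).
move=> t; rewrite /= in_itv/= => tT.
rewrite /scaled_payoff -mulrDr -mulrA ler_wpM2l ?weight_ge0//.
have y0 : 0 <= capacity y t - y t by rewrite subr_ge0 yc.
have z0 : 0 <= capacity z t - z t by rewrite subr_ge0 zc.
apply: (le_trans (powR_midpoint beta_in y0 z0)).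
have cm := capacity_mid t Zy Zz.
set c := capacity (fun u => (y u + z u) / 2) t in cm *.
move: (capacity y t) (capacity z t) (y t) (z t) c y0 z0 cm => cy cz yt zt c ? ? ?.
by apply: ge0_ler_powR; rewrite ?nnegrE ?(ltW beta_gt0)//; lra.
Qed.

Lemma value_le z : admissible z ->
  value z <= \int[mu]_(t in `[t0, T]) (A^-1 `^ beta * capacity_bound `^ beta).
Proof.
move=> Zz; have [mz zM zc] := Zz; apply: le_Rintegral => //.
- exact: scaled_payoff_integrable.
- apply: (@bounded_integrable _ _ _ `|A^-1 `^ beta * capacity_bound `^ beta|) => //.
- move=> t; rewrite /= in_itv/= => tT.
  exact: le_trans (ler_norm _) (scaled_payoff_bounded mz zM zc tT).
Qed.

(** A control that satisfies the constraint almost everywhere only is equal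
    almost everywhere to one that satisfies it everywhere. *)
Lemma admissible_of_ae z : measurable_fun setT z -> (forall t, 0 <= z t <= M) ->
  {ae mu, forall t, t0 <= t <= T -> z t <= capacity z t} ->
  exists2 y, admissible y & value y = value z.
Proof.
move=> mz zM zc.
pose y t := Num.min (z t) (capacity z (clamp t0 T t)).
have my : measurable_fun setT y.
  by apply: measurable_minr => //; exact: measurable_capacity.
have yM t : 0 <= y t <= M.
  have /andP[z0 zM'] := zM t.
  by rewrite /y le_min z0 capacity_ge0 ge_min zM'.
have yz : {ae mu, forall t, t0 <= t <= T -> y t = z t}.
  by apply: (aeS zc) => t H tT; rewrite /y clamp_id// min_l// H.
have yk t : t0 <= t <= T -> scaled_capital y t = scaled_capital z t.
  move=> /andP[t0t tT]; congr (_ + _); apply: ae_eq_Rintegral.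
  - exact: measurable_funTS.
  - exact: measurable_funTS.
  - by apply: (aeS yz) => u H /andP[t0u ut]; apply: H; rewrite t0u (le_trans ut).
have yc t : t0 <= t <= T -> capacity y t = capacity z t.
  by move=> tT; rewrite /capacity yk.
exists y.
  split => // t tT; rewrite yc// /y clamp_id// ge_min lexx orbT//.
apply: ae_eq_Rintegral.
- exact: measurable_scaled_payoff_itv my yM.
- exact: measurable_scaled_payoff_itv mz zM.
- by apply: (aeS yz) => t H tT; rewrite /scaled_payoff yc// H.
Qed.

(** The scaled capital converges pointwise, hence so do the capacity and the
    integrand, almost everywhere; all of them are bounded. *)
Lemma value_closed (w : nat -> R -> R) z : (forall n, admissible (w n)) ->
  measurable_fun setT z -> (forall t, 0 <= z t <= M) ->
  {ae mu, forall t, t0 <= t <= T -> w n t @[n --> \oo] --> z t} ->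
  exists2 y, admissible y & value (w n) @[n --> \oo] --> value y.
Proof.
move=> Zw mz zM wz.
have z0 t : 0 <= z t by case/andP: (zM t).
have w0 n t : 0 <= w n t by case: (Zw n) => _ /(_ t) /andP[].
have mw n : measurable_fun setT (w n) by case: (Zw n).
have wM n t : 0 <= w n t <= M by case: (Zw n).
have wc n t : t0 <= t <= T -> w n t <= capacity (w n) t by case: (Zw n) => _ _; apply.
have wk t : t0 <= t <= T -> scaled_capital (w n) t @[n --> \oo] --> scaled_capital z t.
  move=> /andP[t0t tT]; apply: cvgD; first exact: cvg_cst.
  apply: (@bounded_cvg_Rintegral _ _ _ M).
  - by move=> n; exact: measurable_funTS.
  - exact: measurable_funTS.
  - by move=> n u _; rewrite ger0_norm//; case/andP: (wM n u).
  - by apply: (aeS wz) => u H /andP[t0u ut]; apply: H; rewrite t0u (le_trans ut).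
have wcap t : t0 <= t <= T -> capacity (w n) t @[n --> \oo] --> capacity z t.
  move=> tT; apply: cvgMr; apply: cvg_powR => //; last exact: wk.
  by move=> n; exact: scaled_capital_ge0.
have zc : {ae mu, forall t, t0 <= t <= T -> z t <= capacity z t}.
  apply: (aeS wz) => t H tT; apply: (ler_cvg_to (H tT) (wcap t tT)).
  by apply: nearW => n; exact: wc.
have [y Zy vy] := admissible_of_ae mz zM zc.
exists y; first exact: Zy.
rewrite vy.
apply: (@bounded_cvg_Rintegral _ _ _ (A^-1 `^ beta * capacity_bound `^ beta)).
- by move=> n; exact: measurable_scaled_payoff_itv (mw n) (wM n).
- exact: measurable_scaled_payoff_itv mz zM.
- by move=> n t tT; apply: scaled_payoff_bounded (mw n) (wM n) (wc n) _ tT.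
- apply: (aeS wz) => t H tT; apply: cvgMr; apply: cvg_powR => //.
      by move=> n; rewrite subr_ge0; exact: wc.
  by apply: cvgB; [exact: wcap|exact: H].
Qed.

Lemma scaled_problem_solvable : exists2 z, admissible z &
  forall y, admissible y -> value y <= value z.
Proof.
apply: (@quasiconcave_attains_max _ t0 T M admissible value).
- exact: admissible_neq0.
- by move=> z [].
- by move=> z [].
- exact: admissible_mid.
- exact: value_mid.
- exact: value_le.
- exact: value_closed.
Qed.

End scaled_problem.

(** * Processes and scaled controls *)

Section reduction.
Context {R : realType}.
Local Notation mu := (@lebesgue_measure R).
Local Notation cmu := (@completed_lebesgue_measure R).
Variables (A t0 T lambda sigma k0 alpha beta : R).
Hypothesis A_gt0 : 0 < A.
Hypothesis t0_ge0 : 0 <= t0.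
Hypothesis t0_lt_T : t0 < T.
Hypothesis lambda_ge0 : 0 <= lambda.
Hypothesis sigma_gt0 : 0 < sigma.
Hypothesis k0_ge0 : 0 <= k0.
Hypothesis alpha_in : 0 < alpha <= 1.
Hypothesis beta_in : 0 < beta <= 1.
Implicit Types (k s y z : R -> R) (t : R).

Local Notation gain := (gain A sigma alpha).
Local Notation scaled_capital := (scaled_capital t0 sigma k0).
Local Notation capacity := (capacity A t0 sigma k0 alpha).
Local Notation weight := (weight A lambda sigma beta).
Local Notation value := (value A t0 T lambda sigma k0 alpha beta).
Local Notation scaled_payoff := (scaled_payoff A t0 lambda sigma k0 alpha beta).

(** The bound that Gronwall's inequality gives for the scaled investment of an
    arbitrary feasible process: [1 + K t] grows at a rate of at most [gain T]. *)
Definition control_bound :=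
  gain T * ((1 + expR (sigma * t0) * k0) * expR (gain T * (T - t0))).

Local Notation M := control_bound.
Local Notation admissible := (admissible A t0 T sigma k0 alpha M).
Local Notation feasible := (feasible_process A t0 T lambda sigma k0 alpha beta).
Local Notation payoff := (payoff t0 T lambda alpha beta).

Lemma control_bound_ge0 : 0 <= M.
Proof.
apply: mulr_ge0; first exact: ltW (gain_gt0 sigma alpha A_gt0 T).
apply: mulr_ge0; last exact: expR_ge0.
by rewrite addr_ge0// mulr_ge0// expR_ge0.
Qed.

Let t0_le_T : t0 <= T. Proof. exact: ltW. Qed.

Lemma is_derive_mulf (f g : R -> R) (t df dg : R) :
  is_derive t 1 f df -> is_derive t 1 g dg ->
  is_derive t 1 (fun x => f x * g x) (f t * dg + df * g t).
Proof.
move=> dft dgt; apply: is_derive_eq (is_deriveM dft dgt) _.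
by rewrite /GRing.scale /= (mulrC df).
Qed.

Lemma is_derive_expRM (c t : R) :
  is_derive t 1 (fun x => expR (c * x)) (c * expR (c * t)).
Proof.
have dc : is_derive t 1 (fun x : R => c * x) c.
  have := is_deriveZ c (is_derive_id t (1 : R)).
  by rewrite /GRing.scale /= mulr1.
have := is_derive1_comp (is_derive_expR (c * t)) dc.
by rewrite mulrC.
Qed.

Lemma gain_powR t (x : R) : 0 <= x ->
  gain t * (expR (sigma * t) * x) `^ alpha = A * expR (sigma * t) * x `^ alpha.
Proof.
move=> x0; rewrite powRM ?expR_ge0// {1}/powR gt_eqF ?expR_gt0// expRK.
rewrite /gain -!mulrA; congr (_ * _); rewrite mulrA -expRD; congr (expR _ * _).
by ring.
Qed.

Lemma running_payoff_scaled k s t : 0 <= k t -> s t <= 1 ->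
  running_payoff lambda alpha beta k s t =
  weight t * (gain t * (expR (sigma * t) * k t) `^ alpha -
              A * expR (sigma * t) * k t `^ alpha * s t) `^ beta.
Proof.
move=> k_ge0 s_le1; rewrite gain_powR// -{1}[A * _ * _]mulr1 -mulrBr.
have E0 : 0 <= A * expR (sigma * t) by rewrite mulr_ge0 ?expR_ge0// ltW.
have E1 : 0 <= A^-1 * expR (- sigma * t) by rewrite mulr_ge0 ?expR_ge0// invr_ge0 ltW.
have s1 : 0 <= 1 - s t by rewrite subr_ge0.
rewrite /weight mulrAC -powRM//; last first.
  by apply: mulr_ge0 => //; apply: mulr_ge0 => //; exact: powR_ge0.
have -> : A^-1 * expR (- sigma * t) * (A * expR (sigma * t) * k t `^ alpha * (1 - s t)) =
    (1 - s t) * k t `^ alpha.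
  rewrite mulNr expRN; field.
  by rewrite !gt_eqF ?expR_gt0.
by rewrite powRM ?powR_ge0// -powRrM.
Qed.

(** The saving rate is [z / capacity z]; where the capacity vanishes, so does
    [z], and the saving rate is then [0] as the quotient of [0] by [0]. *)
Lemma process_of_control z : admissible z ->
  exists k s, feasible k s /\ payoff k s = value z.
Proof.
move=> Zz; have [mz zM zc] := Zz.
have z0 t : 0 <= z t by case/andP: (zM t).
pose K := scaled_capital z; pose k t := expR (- sigma * t) * K t.
pose s t := z t / capacity z (clamp t0 T t).
have K0 t : 0 <= K t by apply: scaled_capital_ge0.
have k_ge0 t : 0 <= k t by rewrite mulr_ge0 ?expR_ge0.
have kE t : expR (sigma * t) * k t = K t.
  by rewrite /k mulrA -expRD mulNr subrr expR0 mul1r.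
have c0 t : 0 <= capacity z t by apply: capacity_ge0.
have capE t : A * expR (sigma * t) * k t `^ alpha = capacity z t.
  by rewrite -gain_powR// kE.
have sE t : t0 <= t <= T -> A * expR (sigma * t) * k t `^ alpha * s t = z t.
  move=> tT; rewrite capE /s clamp_id//.
  have [cE|cn0] := eqVneq (capacity z t) 0; last by field.
  by rewrite cE mul0r; apply/eqP; rewrite eq_le z0 -cE zc.
have s01 t : t0 <= t <= T -> 0 <= s t <= 1.
  move=> tT; rewrite /s clamp_id// divr_ge0//=.
  have [cE|cn0] := eqVneq (capacity z t) 0; first by rewrite cE invr0 mulr0.
  by rewrite ler_pdivrMr ?mul1r ?zc// lt_neqAle eq_sym cn0 c0.
have mcap := measurable_capacity A sigma k0 alpha t0_lt_T mz zM.
pose F t := weight t * (capacity z (clamp t0 T t) - z t) `^ beta.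
have mF : measurable_fun setT F.
  exact: (measurable_scaled_payoff _ _ _ _ _ _ t0_lt_T mz zM).
have runE t : t0 <= t <= T -> running_payoff lambda alpha beta k s t = F t.
  move=> tT; rewrite running_payoff_scaled//; last by case/andP: (s01 t tT).
  by rewrite kE (sE t tT) /F (clamp_id tT) capacityE.
have F0 t : 0 <= F t.
  by apply: mulr_ge0; [exact: weight_ge0|exact: powR_ge0].
have FE t : t0 <= t <= T -> F t = scaled_payoff z t.
  by move=> tT; rewrite /F clamp_id.
exists k, s; split; last first.
  transitivity (\int[cmu]_(t in `[t0, T]) F t).
    by apply: eq_Rintegral => t; rewrite inE/= in_itv/= => /runE.
  transitivity (\int[mu]_(t in `[t0, T]) F t).
    exact: Rintegral_completed mF F0.
  by apply: eq_Rintegral => t; rewrite inE/= in_itv/= => /FE.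
split.
- apply: acM; first exact: ac_expR.
  exact: scaled_capital_ac mz zM.
- apply: measurable_lebesgue_type.
  (* The inverse is a power, and powers are measurable functions. *)
  have -> : s = (fun t => z t * capacity z (clamp t0 T t) `^ (-1)).
    by apply/funext => t; rewrite powR_inv1.
  apply: measurable_funM; first exact: mz.
  exact: (@measurableT_comp _ _ _ _ _ _ (@powR R ^~ (-1))).
- apply/ae_completed.
  have := indefinite_integral_derive t0 mz zM.
  move=> /(aeS2 (ae_neq t0)); apply => t tt0 H /andP[t0t tT].
  have {}H : is_derive t 1 K (z t).
    have dz : is_derive t 1 (fun x => \int[mu]_(u in `[t0, x]) z u) (z t).
      by apply: H; rewrite lt_neqAle t0t andbT; apply/eqP => /esym.
    have := @is_deriveD _ _ _ (cst (expR (sigma * t0) * k0)) _ t 1 0 _ _ dz.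
    by rewrite add0r; apply; exact: is_derive_cst.
  have tT' : t0 <= t <= T by rewrite t0t.
  apply: is_derive_eq (is_derive_mulf (is_derive_expRM (- sigma) t) H) _.
  rewrite -(sE t tT') /k.
  have -> : expR (- sigma * t) * (A * expR (sigma * t) * k t `^ alpha * s t) =
      A * k t `^ alpha * s t.
    by rewrite mulNr expRN; field; rewrite gt_eqF ?expR_gt0.
  by ring.
- rewrite /k /K scaled_capital_t0 mulrA -expRD mulNr addrC subrr expR0 mul1r.
  by [].
- by apply: aeW => t; exact: s01.
- by move=> t _.
- pose B := A^-1 `^ beta * capacity_bound A t0 T sigma k0 alpha M `^ beta.
  have : cmu.-integrable (`[t0, T] : set (lebesgue_type R)) (EFin \o F).
    apply: measurable_bounded_integrable.
    + by apply: sub_caratheodory; exact: measurable_itv.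
    + have := @lebesgue_measure_itv R `[t0, T].
      rewrite /= lte_fin t0_lt_T => muE.
      by rewrite [X in (X < _)%E]muE -EFinB ltry.
    + exact: measurable_lebesgue_type.
    + exists B; split; first exact: num_real.
      move=> N BN t /=; rewrite in_itv/= => tT; rewrite FE//.
      apply: le_trans (ltW BN).
      exact: (scaled_payoff_bounded A_gt0 t0_ge0 lambda_ge0 sigma_gt0 k0_ge0 alpha_in
        beta_in control_bound_ge0 mz zM zc tT).
  apply: eq_integrable => [|t]; first by apply: sub_caratheodory; exact: measurable_itv.
  by rewrite inE/= in_itv/= => /runE ->.
Qed.

(** [K] is the scaled capital of the process and [x] its scaled investment; [x]
    is only Lebesgue measurable and is replaced by the Borel function [z]. *)
Lemma control_of_process k s : feasible k s ->
  exists2 z, admissible z & value z = payoff k s.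
Proof.
move=> [kac ms kd kt0 s01 k_ge0 ki].
pose K t := expR (sigma * t) * k t.
pose x t := A * expR (sigma * t) * k t `^ alpha * s t.
have {}kd := (ae_completed _).1 kd; have s01' := (ae_completed _).1 s01.
have Kac : absolutely_continuous t0 T K by apply: acM => //; exact: ac_expR.
have K_ge0 t : t0 <= t <= T -> 0 <= K t.
  by move=> /k_ge0 kt; rewrite mulr_ge0 ?expR_ge0.
have Kt0 : K t0 = expR (sigma * t0) * k0 by rewrite /K kt0.
have Kd : {ae mu, forall t, t0 <= t <= T -> is_derive t 1 K (x t)}.
  apply: (aeS kd) => t H /H {}H.
  apply: is_derive_eq (is_derive_mulf (is_derive_expRM sigma t) H) _.
  by rewrite /x; ring.
have x01 : {ae mu, forall t, t0 <= t <= T -> 0 <= x t <= gain t * K t `^ alpha}.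
  apply: (aeS s01') => t H tT; have /andP[s_ge0 s_le1] := H tT.
  rewrite /x (gain_powR t (k_ge0 t tT)); set c := A * _ * _.
  have c0 : 0 <= c by rewrite mulr_ge0 ?powR_ge0// mulr_ge0 ?expR_ge0// ltW.
  by rewrite mulr_ge0//= ler_piMr.
pose G := gain T.
have G_gt0 : 0 < G by exact: gain_gt0.
have gG t : t0 <= t <= T -> gain t <= G by move=> /andP[_ tT]; exact: gain_le.
(* Gronwall's inequality: [K' <= G * (1 + K)], so the function [u] below is
   nonincreasing. *)
have KM t : t0 <= t <= T -> gain t * K t `^ alpha <= M.
  move=> tT; have Kt := K_ge0 t tT.
  apply: ler_pM; rewrite ?powR_ge0 ?(ltW (gain_gt0 _ _ _ _))//; first exact: gG.
  apply: (le_trans (powR_le1D alpha_in Kt)).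
  have /andP[t0t tT'] := tT.
  pose u r := (K r - (-1)) * expR (- G * r).
  have uac : absolutely_continuous t0 T u.
    by apply: acM; [apply: acB => //; exact: ac_cst|exact: ac_expR].
  have : u t <= u t0.
    apply: (ac_nonincreasing t0t (ac_sub (lexx t0) tT' uac)).
    apply: (aeS2 Kd x01) => r Kr xr /andP[t0r rt].
    have rT : t0 <= r <= T by rewrite t0r (le_trans rt).
    have {}Kr := Kr rT; have /andP[_ xr'] := xr rT.
    exists ((K r + 1) * (- G * expR (- G * r)) + x r * expR (- G * r)); last first.
      have dK : is_derive r 1 (fun v => K v - (-1)) (x r).
        have := is_deriveB Kr (is_derive_cst (-1 : R) r (1 : R)).
        by rewrite subr0.
      apply: is_derive_eq (is_derive_mulf dK (is_derive_expRM (- G) r)) _.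
      by rewrite opprK.
    have -> : (K r + 1) * (- G * expR (- G * r)) + x r * expR (- G * r) =
      expR (- G * r) * (x r - G * (1 + K r)) by ring.
    rewrite mulr_ge0_le0 ?expR_ge0// subr_le0 (le_trans xr')//.
    apply: ler_pM; rewrite ?powR_ge0 ?(ltW (gain_gt0 _ _ _ _))//; first exact: gG.
    exact: powR_le1D (K_ge0 r rT).
  rewrite /u !opprK Kt0 mulNr expRN ler_pdivrMr ?expR_gt0// => /le_trans.
  rewrite (addrC (K t)); apply; rewrite (addrC _ 1) -mulrA.
  apply: ler_wpM2l; first by rewrite addr_ge0// mulr_ge0// expR_ge0.
  rewrite -expRD ler_expR mulNr mulrBr addrC lerD2r.
  by rewrite ler_wpM2l// ltW.
(* Difference quotients of [K], truncated to [[0, M]]. *)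
pose q n t := Num.min M (Num.max 0
  (n.+1%:R * (K (clamp t0 T (t + n.+1%:R^-1)) - K (clamp t0 T t)))).
have mK := measurable_clamp t0_le_T Kac.
have mq n : measurable_fun setT (q n).
  apply: measurable_minr; first exact: measurable_cst.
  apply: measurable_maxr; first exact: measurable_cst.
  apply: measurable_funM; first exact: measurable_cst.
  apply: measurable_funB; last exact: mK.
  apply: (measurableT_comp mK).
  by apply: measurable_funD; [exact: measurable_id|exact: measurable_cst].
have M0 := control_bound_ge0.
have qM n t : 0 <= q n t <= M.
  by rewrite /q le_min M0 le_max lexx ge_min lexx.
have [z [mz zM zq]] := bounded_limit mq qM.
have zx : {ae mu, forall t, t0 <= t <= T -> z t = x t}.
  have := aeS2 Kd x01 (fun t H H' => conj H H').
  move=> /(aeS2 (ae_neq T)); apply => t tnT [Kt xt] tT.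
  have {}Kt := Kt tT; have /andP[x0 xg] := xt tT.
  have xM := le_trans xg (KM t tT).
  apply: zq; apply/cvgrPdist_le => e e0.
  have [r r0 Kr] := is_derive_approx e0 Kt.
  have /andP[t0t tT'] := tT.
  have Tt : 0 < T - t by rewrite subr_gt0 lt_neqAle tT' andbT; apply/eqP.
  have rT0 : 0 < Num.min r (T - t) by rewrite lt_min r0.
  have := @cvg_harmonic R; move=> /cvgr_lt /(_ _ rT0).
  apply: filterS => n; rewrite /harmonic /= lt_min /q.
  have : 0 < n.+1%:R^-1 :> R by rewrite invr_gt0.
  have [h ->] : exists h : R, n.+1%:R = h^-1 by exists n.+1%:R^-1; rewrite invrK.
  rewrite invrK => h0 /andP[hr hT].
  have thT : t0 <= t + h <= T by apply/andP; split; lra.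
  have := Kr (t + h); rewrite addrAC subrr add0r gtr0_norm// => /(_ hr).
  rewrite (clamp_id tT) (clamp_id thT).
  set d := K (t + h) - K t => dx.
  have {dx} : `|h^-1 * d - x t| <= e.
    have -> : h^-1 * d - x t = (d - x t * h) / h by field; rewrite gt_eqF.
    by rewrite normrM normfV (gtr0_norm h0) ler_pdivrMr.
  move: (h^-1 * d) => w; rewrite !ler_norml => /andP[].
  move: x0 xM M0 e0; clear; move: (x t) M => v N v0 vN N0 e0 w1 w2.
  by case: (leP 0 w) => ?; case: (leP N _) => ?; lra.
have KE t : t0 <= t <= T -> K t = scaled_capital z t.
  move=> tT; rewrite scaled_capitalE -Kt0.
  apply: (ac_eq_integral Kac mz zM _ tT).
  by apply: (aeS2 Kd zx) => r Kr zr rT; rewrite zr//; exact: Kr.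
have zc : {ae mu, forall t, t0 <= t <= T -> z t <= capacity z t}.
  apply: (aeS2 zx x01) => t zt xt tT; rewrite zt// capacityE -KE//.
  by case/andP: (xt tT).
have [y Zy vy] := admissible_of_ae lambda beta A_gt0 t0_lt_T mz zM zc.
exists y; first exact: Zy.
rewrite vy; pose F t := weight t * (capacity z (clamp t0 T t) - z t) `^ beta.
have mF : measurable_fun setT F.
  exact: (measurable_scaled_payoff _ _ _ _ _ _ t0_lt_T mz zM).
have F0 t : 0 <= F t.
  by apply: mulr_ge0; [exact: weight_ge0|exact: powR_ge0].
transitivity (\int[mu]_(t in `[t0, T]) F t).
  by apply: eq_Rintegral => t; rewrite inE/= in_itv/= /F => tT; rewrite clamp_id.
rewrite -(Rintegral_completed _ _ mF F0); congr fine; apply: ae_eq_integral.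
- by apply: sub_caratheodory; exact: measurable_itv.
- by apply/measurable_EFinP; exact: measurable_lebesgue_type.
- by case/integrableP: ki.
have {}zx := (ae_completed _).2 zx.
apply: (aeS2 zx s01) => t zt st; rewrite /= in_itv/= => tT.
have /andP[_ s_le1] := st tT.
congr EFin; rewrite (running_payoff_scaled (k_ge0 t tT) s_le1).
by rewrite /F (clamp_id tT) (zt tT) capacityE -(KE t tT).
Qed.

End reduction.

Theorem theorem4p1 (R : realType) (A t0 T lambda sigma k0 : R)
    (A_gt0 : 0 < A) (t0_ge0 : 0 <= t0) (t0_lt_T : t0 < T)
    (lambda_ge0 : 0 <= lambda) (sigma_gt0 : 0 < sigma) (k0_ge0 : 0 <= k0)
    (alpha beta : R) (alpha_in : 0 < alpha <= 1) (beta_in : 0 < beta <= 1) :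
  exists k s : R -> R,
    global_solution A t0 T lambda sigma k0 alpha beta k s.
Proof.
have M0 := control_bound_ge0 t0 T sigma alpha A_gt0 k0_ge0.
have [z Zz zmax] := scaled_problem_solvable A_gt0 t0_ge0 t0_lt_T lambda_ge0
  sigma_gt0 k0_ge0 alpha_in beta_in M0.
have [k [s [ks ksE]]] := process_of_control A_gt0 t0_ge0 t0_lt_T lambda_ge0
  sigma_gt0 k0_ge0 alpha_in beta_in Zz.
exists k, s; split; first exact: ks.
move=> k' s' /(control_of_process A_gt0 t0_lt_T
  sigma_gt0 k0_ge0 alpha_in) [y Zy <-].
by rewrite ksE; exact: zmax.
Qed.
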